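(* Let $z\in\mathcal W=\{u\in\mathbb{R}^m:u_1<\cdots<u_m\}$ and consider the releases $y_\ell=q_\ell(z)+w_\ell$, $\ell=1,\dots,L$, with independent noises $w_\ell\sim\mathcal N(0,\sigma_\ell^2)$, $\sigma_\ell^2=\kappa_L\Delta_{2,\ell}^2$, where $\kappa_L>0$ is a scalar common to all $L$ releases and $\Delta_{2,\ell}>0$. Let $\bm I_C(L)$ be the Fisher information matrix for $z$ and let $$\bm A_L(z)=\sum_{\ell=1}^L g_\ell(z)g_\ell(z)^\top,\qquad g_\ell(z)=\Delta_{2,\ell}^{-1}\nabla_z q_\ell(z),$$ so that $\bm I_C(L)=\kappa_L^{-1}\bm A_L(z)$. Then $$\operatorname{rank}\bigl(\bm I_C(L)\bigr)=\operatorname{rank}\bigl(\bm A_L(z)\bigr);$$ thus local unlabeled identifiability at stage $L$ (i.e. nonsingularity of $\bm I_C(L)$) is equivalent to $\bm A_L(z)\succ\bm 0$. Whenever $\bm A_L(z)\succ\bm 0$, $$\mathrm{CRB}_{\mathrm{unlab}}(L)=\kappa_L\,\operatorname{tr}\bigl(\bm A_L(z)^{-1}\bigr).$$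
   Context: The vector $z=\bm x_C^\uparrow$ is the sorted vector of the $m$ pairwise distinct scalar values of a fixed membership set $C$; each $q_\ell$ is a scalar-valued query, differentiable at $z$; $\Delta_{2,\ell}$ is its $\ell_2$-sensitivity; $\kappa_L$ is the accountant-dependent noise penalty for $L$ releases. There are no nuisance coordinates. The local unlabeled benchmark is defined by $\mathrm{CRB}_{\mathrm{unlab}}(L):=\operatorname{tr}(\bm I_C(L)^{-1})$. *)

(* Defs.v *)
From HB Require Import structures.
From mathcomp Require Import all_boot all_order all_algebra.
From mathcomp Require Import all_classical all_reals all_analysis.

Set Implicit Arguments.
Unset Strict Implicit.
Unset Printing Implicit Defensive.
Import Order.TTheory GRing.Theory Num.Theory.
Import numFieldNormedType.Exports.
Local Open Scope classical_set_scope.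
Local Open Scope ring_scope.

Definition weyl_chamber (R : realType) (m : nat) : set 'cV[R]_m :=
  [set u | forall i j : 'I_m, (i < j)%N -> u i ord0 < u j ord0].

(* For a scalar query the l2-norm of a difference is its absolute value.  The
   neighbouring relation [adj] is a parameter; the value lies in \bar R since
   the supremum need not be finite. *)
Definition l2_sensitivity (R : realType) (D : Type) (adj : D -> D -> Prop)
    (f : D -> R) : \bar R :=
  ereal_sup [set e | exists x y : D, adj x y /\ e = (`|f x - f y|)%:E].

Definition grad (R : realType) (m : nat) (f : 'cV[R]_m -> R) (z : 'cV[R]_m) :
    'cV[R]_m :=
  \col_(i < m) 'D_(delta_mx i ord0) f z.

Definition mutually_independent (R : realType) (d : measure_display)
    (T : measurableType d) (P : probability T R) (L : nat)
    (w : 'I_L -> {RV P >-> R}) : Prop :=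
  forall (J : {set 'I_L}) (B : 'I_L -> set R),
    (forall l, measurable (B l)) ->
    P (\bigcap_(l in [set` J]) (w l @^-1` B l)) =
    (\prod_(l in J) P (w l @^-1` B l))%E.

Definition releases (R : realType) (T : Type) (m L : nat)
    (q : 'I_L -> 'cV[R]_m -> R) (w : 'I_L -> T -> R) (u : 'cV[R]_m) (t : T) :
    'I_L -> R :=
  fun l => q l u + w l t.

(* Under the parameter u the coordinates y_l are independent with law
   N(q_l(u), sigma_l^2), so their joint density with respect to Lebesgue measure
   on R^L is the product of the marginal densities.  The second argument
   of [normal_pdf] is the standard deviation. *)
Definition release_density (R : realType) (m L : nat)
    (q : 'I_L -> 'cV[R]_m -> R) (sigma : 'I_L -> R) (u : 'cV[R]_m)
    (y : 'I_L -> R) : R :=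
  \prod_(l < L) normal_pdf (q l u) (sigma l) (y l).

Definition score (R : realType) (m : nat) (Y : Type)
    (p : 'cV[R]_m -> Y -> R) (z : 'cV[R]_m) (y : Y) : 'cV[R]_m :=
  grad (fun u => ln (p u y)) z.

(* Here [obs] is the observation under the true parameter z, and [p u] is the
   density of the observation under the parameter u. *)
Definition fisher_information (R : realType) (d : measure_display)
    (T : measurableType d) (P : probability T R) (m : nat) (Y : Type)
    (p : 'cV[R]_m -> Y -> R) (obs : T -> Y) (z : 'cV[R]_m) : 'M[R]_m :=
  \matrix_(i < m, j < m)
    fine 'E_P[fun t => score p z (obs t) i ord0 * score p z (obs t) j ord0].

Definition release_fisher (R : realType) (d : measure_display)
    (T : measurableType d) (P : probability T R) (m L : nat)
    (q : 'I_L -> 'cV[R]_m -> R) (sigma : 'I_L -> R)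
    (w : 'I_L -> {RV P >-> R}) (z : 'cV[R]_m) : 'M[R]_m :=
  fisher_information P (release_density q sigma)
    (releases q (fun l => w l : T -> R) z) z.

Definition scaled_grad (R : realType) (m L : nat) (q : 'I_L -> 'cV[R]_m -> R)
    (Delta : 'I_L -> R) (z : 'cV[R]_m) (l : 'I_L) : 'cV[R]_m :=
  (Delta l)^-1 *: grad (q l) z.

Definition geometry_matrix (R : realType) (m L : nat)
    (q : 'I_L -> 'cV[R]_m -> R) (Delta : 'I_L -> R) (z : 'cV[R]_m) : 'M[R]_m :=
  \sum_(l < L) scaled_grad q Delta z l *m (scaled_grad q Delta z l)^T.

Definition posdef (R : realType) (m : nat) (A : 'M[R]_m) : Prop :=
  A^T = A /\
  forall v : 'cV[R]_m, v != 0 -> 0 < (v^T *m A *m v) ord0 ord0.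

Definition locally_identifiable (R : realType) (m : nat) (I : 'M[R]_m) : Prop :=
  I \in unitmx.

Definition CRB (R : realType) (m : nat) (I : 'M[R]_m) : R := \tr (invmx I).

(* Main.v *)
Require Import Defs.
From HB Require Import structures.
From mathcomp Require Import all_boot all_order all_algebra.
From mathcomp Require Import all_classical all_reals all_analysis.
From mathcomp Require Import measurable_realfun ring lra.
Set Implicit Arguments.
Unset Strict Implicit.
Unset Printing Implicit Defensive.
Import Order.TTheory GRing.Theory Num.Theory.
Import numFieldNormedType.Exports.
Local Open Scope classical_set_scope.
Local Open Scope ring_scope.

(* The score at the true parameter is the sum over l of
   (w_l / sigma_l^2) grad q_l(z), so I is the double sum over l, k of
   E[w_l w_k] / (sigma_l sigma_k)^2 times the outer product of the gradients.
   The noises are uncorrelated with variance sigma_l^2 = kappa Delta_l^2, which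
   leaves kappa^-1 A.  A sum of outer products g g^T is positive semidefinite
   and its isotropic vectors are annihilated by every g^T, so A is positive
   definite exactly when it is invertible. *)

(** * Linear algebra of sums of outer products *)

Lemma geometry_matrix_tr (R : realType) (m L : nat)
    (q : 'I_L -> 'cV[R]_m -> R) (Delta : 'I_L -> R) (z : 'cV[R]_m) :
  (geometry_matrix q Delta z)^T = geometry_matrix q Delta z.
Proof.
by rewrite /geometry_matrix raddf_sum; apply: eq_bigr => l _; rewrite /= trmx_mul trmxK.
Qed.

Lemma geometry_matrix_form (R : realType) (m L : nat)
    (q : 'I_L -> 'cV[R]_m -> R) (Delta : 'I_L -> R) (z v : 'cV[R]_m) :
  (v^T *m geometry_matrix q Delta z *m v) ord0 ord0 =
  \sum_(l < L) ((scaled_grad q Delta z l)^T *m v) ord0 ord0 ^+ 2.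
Proof.
rewrite /geometry_matrix mulmx_sumr mulmx_suml summxE; apply: eq_bigr => l _.
set g := scaled_grad _ _ _ _.
rewrite mulmxA -mulmxA mxE big_ord1 expr2; congr (_ * _).
by rewrite -[g in LHS]trmxK -trmx_mul mxE.
Qed.

Lemma posdef_geometry_matrix (R : realType) (m L : nat)
    (q : 'I_L -> 'cV[R]_m -> R) (Delta : 'I_L -> R) (z : 'cV[R]_m) :
  posdef (geometry_matrix q Delta z) <-> geometry_matrix q Delta z \in unitmx.
Proof.
set A := geometry_matrix q Delta z; split => [[_ Apos]|Aunit].
  (* A nonzero row [u] with [u *m A = 0] would make the quadratic form vanish at [u^T]. *)
  rewrite -row_free_unit -kermx_eq0; apply/negPn/negP => /rowV0Pn[u].
  move=> /sub_kermxP uA0 u0.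
  have /Apos : u^T != 0 by rewrite -(inj_eq (@trmx_inj _ _ _)) trmxK trmx0.
  by rewrite trmxK uA0 mul0mx mxE ltxx.
split=> [|v v0]; first exact: geometry_matrix_tr.
rewrite lt_neqAle geometry_matrix_form sumr_ge0 ?andbT => [|l _]; last exact: sqr_ge0.
apply: contra_neq v0 => /esym/eqP; rewrite psumr_eq0 => [/allP gv0|l _]; last exact: sqr_ge0.
(* [v] is recovered as [invmx A *m (A *m v)], and each term of [A *m v] carries a factor [g^T *m v],
   which is zero. *)
rewrite -[v](mulKmx Aunit) [A *m v]mulmx_suml big1 ?mulmx0// => l _.
rewrite -mulmxA (_ : _ *m v = 0) ?mulmx0//.
apply/matrixP => i j; rewrite !ord1 [RHS]mxE; apply/eqP.
by rewrite -sqrf_eq0 (implyP (gv0 l (mem_index_enum _))).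
Qed.

(** * Score of the Gaussian releases *)

(** The noise levels do not depend on the parameter, so the log-normalisers form a constant [c] and
    only the quadratic exponents contribute to the gradient. *)
Lemma score_release_density (R : realType) (m L : nat)
    (q : 'I_L -> 'cV[R]_m -> R) (sigma : 'I_L -> R) (z : 'cV[R]_m)
    (y : 'I_L -> R) :
  (forall l, differentiable (q l) z) -> (forall l, 0 < sigma l) ->
  score (release_density q sigma) z y =
  \sum_(l < L) ((y l - q l z) / sigma l ^+ 2) *: grad (q l) z.
Proof.
move=> q_diff sigma_gt0; apply/matrixP => i j; rewrite mxE summxE (ord1 j) {j}.
pose c := \sum_(l < L) ln (normal_peak (sigma l)).
pose h (l : 'I_L) (u : 'cV[R]_m) := - ((y l - q l u) ^+ 2 / (sigma l ^+ 2 *+ 2)).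
have -> : (fun u => ln (release_density q sigma u y)) =
    cst c + \sum_(l < L) h l.
  apply/funext => u; rewrite /release_density fctE fct_sumE -big_split/=.
  have s0 (l : 'I_L) : sigma l != 0 by rewrite gt_eqF.
  have pos (l : 'I_L) : 0 < normal_pdf (q l u) (sigma l) (y l).
    by rewrite normal_pdfE// mulr_gt0 ?expR_gt0// normal_peak_gt0.
  transitivity (\sum_(l < L) ln (normal_pdf (q l u) (sigma l) (y l))).
    (* [lnM] asks for positive factors, so positivity of the partial product is carried along with
       the identity. *)
    have [] : 0 < \prod_(l < L) normal_pdf (q l u) (sigma l) (y l) /\
        ln (\prod_(l < L) normal_pdf (q l u) (sigma l) (y l)) =
        \sum_(l < L) ln (normal_pdf (q l u) (sigma l) (y l)); last by move=> _ ->.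
    elim/big_rec2: _ => [|l s p _ [s0' <-]]; first by rewrite ln1.
    by split; [exact: mulr_gt0|rewrite lnM ?posrE].
  apply: eq_bigr => l _; rewrite normal_pdfE// lnM ?posrE ?expR_gt0 ?normal_peak_gt0//.
  by rewrite /normal_fun expRK mulNr.
have dq l : derivable (q l) z (delta_mx i ord0) by exact: diff_derivable.
have dh l : is_derive z (delta_mx i ord0) (h l)
    ((y l - q l z) / sigma l ^+ 2 * 'D_(delta_mx i ord0) (q l) z).
  have Dq := derivableP (dq l).
  (* In this combinator form the [is_derive] instances, with [Dq] for [q l], compute the
     derivative. *)
  have -> : h l = - (sigma l ^+ 2 *+ 2)^-1 *: (cst (y l) - q l) ^+ 2.
    by apply/funext => u; rewrite /h !fctE scaleNr /GRing.scale/= mulrC.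
  apply: is_derive_eq; rewrite !fctE.
  have := sigma_gt0 l; set s := sigma l => sp.
  rewrite /GRing.scale/=.
  by field; rewrite gt_eqF.
rewrite deriveD; [|exact: derivable_cst|by apply: derivable_sum].
rewrite derive_cst add0r derive_sum//.
by apply: eq_bigr => l _; rewrite !mxE; exact: derive_val.
Qed.

(** * Second moment of the centred normal law *)

(** [normal_pdf] and the Radon-Nikodym derivative of [normal_prob] have the same integral over every
    measurable set, hence agree almost everywhere. *)
Lemma ge0_integral_normal_prob (R : realType) (m s : R) (f : _ -> \bar R) :
  measurable_fun setT f -> (forall x, (0 <= f x)%E) ->
  (\int[normal_prob m s]_x f x =
   \int[lebesgue_measure]_x (f x * (normal_pdf m s x)%:E))%E.
Proof.
move=> mf f0.
have dom := normal_prob_dominates m s.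
rewrite -(Radon_Nikodym_SigmaFinite.change_of_variables dom)//.
have mp : measurable_fun setT (fun x => (normal_pdf m s x)%:E).
  by apply/measurable_EFinP; exact: measurable_normal_pdf.
have intRN := Radon_Nikodym_SigmaFinite.f_integrable dom.
apply: ae_eq_integral => //.
- by apply: emeasurable_funM => //; exact: measurable_int intRN.
- exact: emeasurable_funM.
- apply: ae_eqe_mul2l; apply: integral_ae_eq => // E _ mE.
  by rewrite -Radon_Nikodym_SigmaFinite.f_integral.
Qed.

(** Supplies the boundary term at infinity for the second moment. With [t = x^2 / (2 s^2)], the
    bound [1 + t <= expR t] yields [t * expR (- t) <= 1], so the function is at most [c / x]. *)
Lemma cvg_id_normal_pdf (R : realType) (s : R) : 0 < s ->
  x * normal_pdf 0 s x @[x --> +oo] --> (0 : R).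
Proof.
move=> s0; pose c : R := normal_peak s * (s ^+ 2 *+ 2).
have c0 : 0 < c by rewrite mulr_gt0 ?normal_peak_gt0 ?gt_eqF// pmulrn_lgt0// exprn_gt0.
apply: (@squeeze_cvgr _ _ _ _ (cst 0) (fun x => c * x^-1)).
- near=> x.
  have x0 : 0 < x by [].
  rewrite mulr_ge0 ?normal_pdf_ge0 ?(ltW x0)//=.
  rewrite ler_pdivlMr// normal_pdfE ?gt_eqF// /normal_fun subr0.
  set t := x ^+ 2 / (s ^+ 2 *+ 2).
  have t0 : 0 < t by rewrite divr_gt0 ?exprn_gt0// pmulrn_lgt0// exprn_gt0.
  have : t * expR (- t) <= 1.
    rewrite -ler_pdivlMr ?expR_gt0// div1r -expRN opprK.
    by rewrite (le_trans _ (expR_ge1Dx t))// lerDr.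
  have -> : x * (normal_peak s * expR (- x ^+ 2 / (s ^+ 2 *+ 2))) * x = c * (t * expR (- t)).
    by rewrite mulNr -/t /c /t; field; rewrite gt_eqF.
  by move=> ?; rewrite ger_pMr.
- exact: cvg_cst.
- rewrite -[0](mulr0 c); apply: cvgM; first exact: cvg_cst.
  by apply/gtr0_cvgV0; [exact: nbhs_pinfty_gt|exact: cvg_id].
Unshelve. all: by end_near. Qed.


(** Since the density [p] satisfies [p' = - (x / s^2) p], this primitive compares the integrals of
    [x^2 p] and [s^2 p] without computing either. *)
Lemma is_derive_id_normal_pdf (R : realType) (s x : R) : 0 < s ->
  is_derive x 1 (fun x => s ^+ 2 * (x * normal_pdf 0 s x))
    ((s ^+ 2 - x ^+ 2) * normal_pdf 0 s x).
Proof.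
move=> s0; rewrite normal_pdfE ?gt_eqF// /normal_fun.
apply: is_derive_eq.
rewrite /GRing.scale/= subr0.
by field; rewrite gt_eqF.
Qed.

(** The integrals of [x^2 p] and [s^2 p] agree on the half-line because [F] vanishes at 0 and at
    infinity; evenness extends this to the whole line, where [p] has mass one. *)
Lemma normal_second_moment (R : realType) (s : R) : 0 < s ->
  (\int[normal_prob 0 s]_x (x ^+ 2)%:E = (s ^+ 2)%:E)%E.
Proof.
move=> s0; pose mu := @lebesgue_measure R; set p := normal_pdf 0 s.
have sN0 : s != 0 by rewrite gt_eqF.
pose F x := s ^+ 2 * (x * p x).
have p0 x : 0 <= p x by exact: normal_pdf_ge0.
have cp : continuous p by exact: continuous_normal_pdf.
have mp : measurable_fun setT p by exact: measurable_normal_pdf.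
have dF x : derivable F x 1 by have := is_derive_id_normal_pdf x s0 => -[].
have F'E x : F^`()%classic x = (s ^+ 2 - x ^+ 2) * p x.
  by rewrite derive1E; have [_] := is_derive_id_normal_pdf x s0.
have cF : continuous F.
  by move=> x; apply: differentiable_continuous; exact/derivable1_diffP.
have csq : continuous (fun x : R => x ^+ 2) by exact: exprn_continuous.
have cG : continuous (fun x : R => (s ^+ 2 - x ^+ 2) * p x).
  by move=> x; apply: cvgM; [apply: cvgB; [exact: cvg_cst|exact: csq]|exact: cp].
have cH : continuous (fun x : R => x ^+ 2 * p x).
  by move=> x; apply: cvgM; [exact: csq|exact: cp].
have cN : continuous (fun x : R => (x ^+ 2 - s ^+ 2) * p x).
  by move=> x; apply: cvgM; [apply: cvgB; [exact: csq|exact: cvg_cst]|exact: cp].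
have mG := continuous_measurable_fun cG.
have mN := continuous_measurable_fun cN.
have mH := continuous_measurable_fun cH.
have inner : (\int[mu]_(x in `[0%R, s]) ((s ^+ 2 - x ^+ 2) * p x)%:E = (F s)%:E)%E.
  rewrite (@continuous_FTC2 _ _ F)//.
  - by rewrite /F mul0r mulr0 sube0.
  - by apply: continuous_subspaceT => x; exact: cG.
  - split => [x _||]; first exact: dF.
    + by apply: cvg_at_right_filter; exact: cF.
    + by apply: cvg_at_left_filter; exact: cF.
(* The primitive here is [- F], with limit 0 at infinity, so the integral is [0 - (- F s)]. *)
have outer : (\int[mu]_(x in `[s, +oo[) ((x ^+ 2 - s ^+ 2) * p x)%:E = (F s)%:E)%E.
  rewrite (@ge0_continuous_FTC2y _ _ (- F) _ 0)//.
  - by rewrite sub0e -EFinN opprK.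
  - move=> x sx; rewrite mulr_ge0// subr_ge0 ler_pXn2r// nnegrE ltW//.
    exact: lt_le_trans sx.
  - by apply: continuous_subspaceT => x; exact: cN.
  - rewrite -oppr0; apply: cvgN.
    rewrite -[0](mulr0 (s ^+ 2)); apply: cvgM; first exact: cvg_cst.
    exact: cvg_id_normal_pdf.
  - by move=> x _; exact: derivableN.
  - by apply: cvgN; apply: cvg_at_right_filter; exact: cF.
  - by move=> x _; rewrite derive1N// F'E -mulNr opprB.
have cS : continuous (fun x : R => s ^+ 2 * p x).
  by move=> x; apply: cvgM; [exact: cvg_cst|exact: cp].
have mS := continuous_measurable_fun cS.
have H0 x : 0 <= x ^+ 2 * p x by rewrite mulr_ge0 ?sqr_ge0.
have S0 x : 0 <= s ^+ 2 * p x by rewrite mulr_ge0 ?sqr_ge0.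
have split_itv (f : R -> R) : (forall x, 0 <= f x) -> measurable_fun setT f ->
    (\int[mu]_(x in `[0%R, +oo[) (f x)%:E =
     \int[mu]_(x in `[0%R, s]) (f x)%:E + \int[mu]_(x in `[s, +oo[) (f x)%:E)%E.
  (* The cut produces [[0, s[] and [[s, +oo[]; closing the first interval at [s] adds a null set. *)
  move=> f0 mf; rewrite (@itv_bndbnd_setU _ _ _ (BLeft s)) ?bnd_simp ?(ltW s0)//.
  rewrite ge0_integral_setU//=.
  - congr (_ + _)%E; apply: integral_itv_bndo_bndc.
    exact/measurable_EFinP/measurable_funTS.
  - exact/measurable_EFinP/measurable_funTS.
  - by move=> x _; rewrite lee_fin.
  - apply/disj_setPS => x [/=]; rewrite !in_itv/= andbT => /andP[_ xs].
    by rewrite leNgt xs.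
(* The integrals of s^2 p and x^2 p differ by F s on [0, s] and by - F s on
   [s, +oo[; cutting at s, where F' changes sign, keeps every integrand
   nonnegative, so that no integrability is needed. *)
have half : (\int[mu]_(x in `[0%R, +oo[) (x ^+ 2 * p x)%:E =
    \int[mu]_(x in `[0%R, +oo[) (s ^+ 2 * p x)%:E)%E.
  rewrite !split_itv//.
  have -> : (\int[mu]_(x in `[0%R, s]) (s ^+ 2 * p x)%:E =
      \int[mu]_(x in `[0%R, s]) (x ^+ 2 * p x)%:E + (F s)%:E)%E.
    rewrite -inner -ge0_integralD//=.
    - by apply: eq_integral => x _; rewrite -EFinD; congr EFin; ring.
    - by move=> x _; rewrite lee_fin.
    - exact/measurable_EFinP/measurable_funTS.
    - move=> x; rewrite in_itv/= => /andP[x0 xs].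
      by rewrite lee_fin mulr_ge0// subr_ge0 ler_pXn2r// nnegrE ltW.
    - exact/measurable_EFinP/measurable_funTS.
  rewrite -addeA; congr (_ + _)%E.
  rewrite -outer -ge0_integralD//=.
  - by apply: eq_integral => x _; rewrite -EFinD; congr EFin; ring.
  - move=> x; rewrite in_itv/= andbT => sx.
    rewrite lee_fin mulr_ge0// subr_ge0 ler_pXn2r// nnegrE ltW//.
    exact: lt_le_trans sx.
  - exact/measurable_EFinP/measurable_funTS.
  - by move=> x _; rewrite lee_fin.
  - exact/measurable_EFinP/measurable_funTS.
have even_p x : p (- x) = p x by rewrite /p normal_pdfE// /normal_fun !subr0 sqrrN.
rewrite ge0_integral_normal_prob//=; last 2 first.
  - exact/measurable_EFinP/measurable_funX.
  - by move=> x; rewrite lee_fin sqr_ge0.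
transitivity (\int[mu]_x (s ^+ 2 * p x)%:E)%E.
  under eq_integral do rewrite -EFinM -/p.
  rewrite !ge0_symfun_integralT//.
  - by rewrite -set_itvcy half.
  - by move=> x /=; rewrite even_p.
  - by move=> x /=; rewrite even_p sqrrN.
under eq_integral do rewrite EFinM.
by rewrite integralZl ?integral_normal_pdf ?mule1//; exact: integrable_normal_pdf.
Qed.

(** * Uncorrelatedness of the noises by symmetry *)

(** Lebesgue measure is invariant under negation and the centred density is even. *)
Lemma normal_prob0N (R : realType) (s : R) (A : set R) : s != 0 ->
  measurable A -> normal_prob 0 s (-%R @^-1` A) = normal_prob 0 s A.
Proof.
move=> s0 mA; pose mu := @lebesgue_measure R; rewrite /normal_prob.
transitivity (\int[pushforward mu (-%R : _ -> measurableTypeR R)]_(x in A)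
    (normal_pdf 0 s x)%:E)%E; last first.
  by apply: eq_measure_integral => B mB _; exact: lebesgue_measureN.
rewrite ge0_integral_pushforward//.
- by apply: eq_integral => x _; rewrite /= normal_pdfE// /normal_fun !subr0 sqrrN.
- by apply: measurable_funTS; apply/measurable_EFinP; exact: measurable_normal_pdf.
- by move=> x _; rewrite lee_fin normal_pdf_ge0.
Qed.

(* (X, Y) and (-X, Y) have the same law, the product of the marginals, hence
   E[XY] = -E[XY]. *)
Lemma expectation_mul_symmetric (R : realType) (d : measure_display)
    (T : measurableType d) (P : probability T R) (X Y : {RV P >-> R}) :
  (forall A : set R, measurable A ->
     distribution P X (-%R @^-1` A) = distribution P X A) ->
  (forall A B : set R, measurable A -> measurable B ->
     P (X @^-1` A `&` Y @^-1` B) = (P (X @^-1` A) * P (Y @^-1` B))%E) ->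
  P.-integrable setT (EFin \o (X \* Y)) ->
  ('E_P[X \* Y] = 0)%E.
Proof.
move=> X_sym XY_indep iXY.
have mXY : measurable_fun setT (fun t => (X t, Y t)).
  exact: measurable_fun_pair.
have mNX : measurable_fun setT (fun t => - X t) by exact: measurableT_comp.
have mNXY : measurable_fun setT (fun t => (- X t, Y t)).
  exact: measurable_fun_pair.
pose XY : {RV P >-> (R * R)%type} :=
  HB.pack (fun t => (X t, Y t)) (isMeasurableFun.Build _ _ _ _ _ mXY).
pose NXY : {RV P >-> (R * R)%type} :=
  HB.pack (fun t => (- X t, Y t)) (isMeasurableFun.Build _ _ _ _ _ mNXY).
have same_law S : measurable S -> distribution P NXY S = distribution P XY S.
  move=> mS; transitivity ((distribution P X \x distribution P Y)%E S).
    apply/esym/product_measure_unique => // A B mA mB.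
    (* [X_sym] trades [A] for its reflection, so that the event on [- X] becomes one on [X], to
       which independence applies. *)
    rewrite /= -X_sym//; apply: XY_indep => //.
    by rewrite -[X in measurable X]setTI; exact: oppr_measurable.
  by apply: product_measure_unique => // A B; exact: XY_indep.
pose f (xy : (R * R)%type) := (xy.1 * xy.2)%:E.
have mf : measurable_fun setT f by exact/measurable_EFinP/measurable_funM.
have EXY : ('E_P[X \* Y] = - 'E_P[X \* Y])%E.
  rewrite [in RHS]unlock -integralN; last exact: integrable_add_def.
  rewrite [in LHS]unlock.
  transitivity (\int[distribution P XY]_z f z)%E.
    by rewrite integral_distribution.
  transitivity (\int[distribution P NXY]_z f z)%E.
    by apply: eq_measure_integral => S mS _; exact/esym/same_law.
  rewrite integral_distribution//=.
    by apply: eq_integral => t _; exact: (congr1 EFin (mulNr _ _)).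
  apply: eq_integrable (integrableN iXY) => // t _.
  exact/esym/(congr1 EFin (mulNr _ _)).
have /fineK fin : ('E_P[X \* Y])%E \is a fin_num.
  by rewrite unlock integrable_fin_num.
rewrite -fin; congr EFin; move: EXY; rewrite -fin -EFinN => -[] /eqP.
by rewrite -addr_eq0 -mulr2n mulrn_eq0/= => /eqP.
Qed.

(** * Fisher information of the releases *)

Lemma release_fisherE (R : realType) (m L : nat) (q : 'I_L -> 'cV[R]_m -> R)
    (z : 'cV[R]_m) (sigma : 'I_L -> R)
    (d : measure_display) (T : measurableType d) (P : probability T R)
    (w : 'I_L -> {RV P >-> R}) :
  (forall l, differentiable (q l) z) ->
  (forall l, 0 < sigma l) ->
  (forall l k, P.-integrable setT (fun t => (w l t * w k t)%:E)) ->
  (forall l k, (\int[P]_t (w l t * w k t)%:E =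
      (if l == k then sigma l ^+ 2 else 0)%:E)%E) ->
  release_fisher q sigma w z =
  \sum_(l < L) (sigma l ^- 2) *: (grad (q l) z *m (grad (q l) z)^T).
Proof.
move=> q_diff sigma_gt0 iw Ew; apply/matrixP => i j; rewrite mxE summxE.
(* At the true parameter the residual of release [l] is [w l], so [c l k] is the coefficient of
   [w l * w k] in the product of the score entries [i] and [j]. *)
pose c l k := (grad (q l) z i ord0 / sigma l ^+ 2) * (grad (q k) z j ord0 / sigma k ^+ 2).
rewrite unlock.
have -> : (fun t => (score (release_density q sigma) z
      (releases q (fun l => w l : T -> R) z t) i ord0 *
    score (release_density q sigma) z
      (releases q (fun l => w l : T -> R) z t) j ord0)%:E) =
    (fun t => \sum_(l < L) \sum_(k < L) (c l k)%:E * (w l t * w k t)%:E)%E.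
  apply/funext => t; rewrite score_release_density// !summxE mulr_suml.
  rewrite -sumEFin; apply: eq_bigr => l _.
  rewrite mulr_sumr -sumEFin; apply: eq_bigr => k _; rewrite -EFinM; congr EFin.
  by rewrite /releases ![X in X * _]mxE ![X in _ * X]mxE /c; ring.
rewrite integral_sum//=; last by move=> l; apply: integrable_sum => // k _; exact: integrableZl.
have -> : (\sum_(l < L) \int[P]_t (\sum_(k < L) (c l k)%:E * (w l t * w k t)%:E))%E =
    (\sum_(l < L) c l l * sigma l ^+ 2)%:E.
  rewrite -sumEFin; apply: eq_bigr => l _.
  rewrite integral_sum//=; last by move=> k; exact: integrableZl.
  rewrite (bigD1 l)//= integralZl// Ew eqxx big1 ?adde0 ?EFinM// => k kl.
  by rewrite integralZl// Ew eq_sym (negbTE kl) mule0.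
rewrite /=; apply: eq_bigr => l _; rewrite [RHS]mxE [(_ *m _) i j]mxE big_ord1 [_^T _ _]mxE /c.
by field; rewrite gt_eqF.
Qed.

Theorem theorem2 (R : realType) (m L : nat)
    (* datasets, neighbouring relation, queries; [data u] is the dataset whose
       sorted values on C are u (everything else being fixed and known) *)
    (D : Type) (adj : D -> D -> Prop) (query : 'I_L -> D -> R)
    (data : 'cV[R]_m -> D)
    (z : 'cV[R]_m) (kappa : R) (Delta sigma : 'I_L -> R)
    (d : measure_display) (T : measurableType d) (P : probability T R)
    (w : 'I_L -> {RV P >-> R})
    (z_sorted : weyl_chamber z)
    (q_diff : forall l, differentiable (fun u => query l (data u)) z)
    (kappa_gt0 : 0 < kappa)
    (Delta_sens : forall l, l2_sensitivity adj (query l) = (Delta l)%:E)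
    (Delta_gt0 : forall l, 0 < Delta l)
    (sigma_gt0 : forall l, 0 < sigma l)
    (sigma_sq : forall l, sigma l ^+ 2 = kappa * Delta l ^+ 2)
    (w_normal : forall l (B : set R), measurable B ->
       distribution P (w l) B = normal_prob 0 (sigma l) B)
    (w_indep : mutually_independent w) :
  let q := fun l u => query l (data u) in
  let I := release_fisher q sigma w z in
  let A := geometry_matrix q Delta z in
  [/\ I = kappa^-1 *: A,
      \rank I = \rank A,
      locally_identifiable I <-> posdef A &
      posdef A -> CRB I = kappa * \tr (invmx A)].
Proof.
move=> q I A.
have sigma_neq0 l : sigma l != 0 by rewrite gt_eqF.
have kappa_neq0 : kappa != 0 by rewrite gt_eqF.
have square_law l : (\int[P]_t (w l t ^+ 2)%:E = (sigma l ^+ 2)%:E)%E.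
  rewrite -(normal_second_moment (sigma_gt0 l)).
  transitivity (\int[pushforward P (w l : T -> measurableTypeR R)]_x (x ^+ 2)%:E)%E.
    rewrite ge0_integral_pushforward//.
    - exact: (measurable_funPT (w l)).
    - exact/measurable_EFinP/measurable_funX.
    - by move=> y _; rewrite lee_fin sqr_ge0.
  apply: eq_measure_integral => [|mw B mB _]; first exact: (measurable_funPT (w l)).
  exact: w_normal.
(* The product is dominated through [|a b| <= a^2 + b^2], and the squares are integrable by
   [square_law]. *)
have iw l k : P.-integrable setT (fun t => (w l t * w k t)%:E).
  have isq h : P.-integrable setT (fun t => (w h t ^+ 2)%:E).
    apply/integrableP; split; first exact/measurable_EFinP/measurable_funX.
    under eq_integral do rewrite gee0_abs ?lee_fin ?sqr_ge0//.
    by rewrite square_law ltry.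
  apply: (@le_integrable _ _ _ P _ _ _ (fun t => (w l t ^+ 2)%:E + (w k t ^+ 2)%:E)%E) => //.
  - exact/measurable_EFinP/measurable_funM.
  - move=> t _; rewrite -EFinD !abse_EFin lee_fin normrM [leRHS]ger0_norm ?addr_ge0 ?sqr_ge0//.
    rewrite -(real_normK (num_real (w l t))) -(real_normK (num_real (w k t))).
    by have := sqr_ge0 (`|w l t| - `|w k t|); have := sqr_ge0 (`|w l t| + `|w k t|); nra.
  - exact: integrableD.
have Ew l k : (\int[P]_t (w l t * w k t)%:E = (if l == k then sigma l ^+ 2 else 0)%:E)%E.
  have [->|lk] := eqVneq l k; first by rewrite -square_law; apply: eq_integral => t _; rewrite expr2.
  transitivity ('E_P[w l \* w k])%E; first by rewrite unlock.
  apply: expectation_mul_symmetric => //.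
  - move=> B mB; rewrite !w_normal ?normal_prob0N//.
    by rewrite -[X in measurable X]setTI; exact: oppr_measurable.
  - move=> B C mB mC.
    (* Mutual independence is applied to the pair of indices [l], [k], with the family equal to [B]
       at [l] and to [C] at every other index, hence at [k]. *)
    have mBC h : measurable (if h == l then B else C) by case: ifP.
    have := w_indep [set l; k]%SET (fun h => if h == l then B else C) mBC.
    rewrite big_setU1 ?inE//= big_set1 eqxx eq_sym (negbTE lk) => <-.
    congr (P _); apply/seteqP; split => t /=.
      by move=> [Bt Ct] h /=; rewrite !inE => /orP[] /eqP ->; rewrite ?eqxx// eq_sym (negbTE lk).
    move=> h; split.
      by have := h l; rewrite /= eqxx !inE eqxx; apply.
    by have := h k; rewrite /= eq_sym (negbTE lk) !inE eqxx orbT; apply.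
  - exact: iw.
have IE : I = kappa^-1 *: A.
  rewrite /I (@release_fisherE _ _ _ q z _ _ _ _ _ q_diff sigma_gt0 iw Ew) /A /geometry_matrix.
  rewrite scaler_sumr; apply: eq_bigr => l _.
  (* The two factors [(Delta l)^-1] of the outer product account for [Delta l ^+ 2] in [sigma_sq],
     leaving the scalar [kappa^-1] common to all [l]. *)
  rewrite /scaled_grad linearZ/= -scalemxAl -scalemxAr !scalerA sigma_sq.
  by congr (_ *: _); field; rewrite kappa_neq0 gt_eqF.
have kV_unit : kappa^-1 \is a GRing.unit by rewrite unitfE invr_eq0.
split=> //.
- by rewrite IE mxrank_scale_nz// invr_eq0.
- by rewrite /locally_identifiable IE unitmxZ//; apply: iff_sym; exact: posdef_geometry_matrix.
(* [invmx] returns its argument on a singular matrix, so the scalar is inverted only once positive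
   definiteness has given invertibility. *)
- move=> /posdef_geometry_matrix Aunit.
  by rewrite /CRB IE invmxZ ?unitmxZ// invrK mxtraceZ.
Qed.
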